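(* Let $n \ge 2$ be an integer and let $G(\mathbb{Z}_n)$ be the unit graph of $\mathbb{Z}_n$. Let $p$ be a prime number. Then: (1) If $n$ is even, then $$SO(G(\mathbb{Z}_n)) = \frac{n(\phi(n))^2}{\sqrt{2}}.$$ (2) If $n=p^\alpha$ with $\alpha \geq 1$ an integer and $p > 2$, then $$SO(G(\mathbb{Z}_n)) = \phi(n)(n-\phi(n))\sqrt{(\phi(n))^2 + (\phi(n)-1)^2} + \frac{\big[\phi(n)(\phi(n)-1) - (n-\phi(n))\phi(n)\big](\phi(n)-1)}{\sqrt{2}}.$$
   Context: For a finite simple graph $G$, the Sombor index is $SO(G)=\sum_{uv\in E(G)}\sqrt{d_u^2+d_v^2}$, the sum being over (unordered) edges, where $d_x$ is the degree of the vertex $x$. For a commutative ring $R$ with unity, $U(R)$ denotes the set of units of $R$. The unit graph $G(R)$ is the simple graph whose vertices are all elements of $R$, with distinct vertices $x,y$ adjacent if and only if $x+y\in U(R)$. $\mathbb{Z}_n$ is the ring of integers modulo $n$ and $\phi$ is Euler's totient function. *)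

(* Defs.v *)
From mathcomp Require Import all_boot all_order all_algebra.
From mathcomp Require Import reals.

Set Implicit Arguments.
Unset Strict Implicit.
Unset Printing Implicit Defensive.

Import Order.TTheory GRing.Theory Num.Theory.
Local Open Scope ring_scope.

Record sgraph (T : Type) := SGraph {
  adj : rel T;
  adj_sym : symmetric adj;
  adj_irrefl : irreflexive adj
}.

Definition degree (T : finType) (G : sgraph T) (x : T) : nat :=
  #|[set y | adj G x y]|.

Definition edges (T : finType) (G : sgraph T) : {set {set T}} :=
  [set e | [exists x, exists y, adj G x y && (e == [set x; y])]].

(* Each edge e = {u, v} is counted once; since u <> v, the inner sum is
   d_u ^ 2 + d_v ^ 2. *)
Definition sombor (R : realType) (T : finType) (G : sgraph T) : R :=
  \sum_(e in edges G) Num.sqrt (\sum_(x in e) (degree G x)%:R ^+ 2).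

Definition unit_adj (A : comUnitRingType) : rel A :=
  fun x y => (x != y) && (x + y \is a GRing.unit).

Lemma unit_adj_sym (A : comUnitRingType) : symmetric (@unit_adj A).
Proof. by move=> x y; rewrite /unit_adj eq_sym addrC. Qed.

Lemma unit_adj_irrefl (A : comUnitRingType) : irreflexive (@unit_adj A).
Proof. by move=> x; rewrite /unit_adj eqxx. Qed.

Definition unit_graph (A : comUnitRingType) : sgraph A :=
  SGraph (@unit_adj_sym A) (@unit_adj_irrefl A).

(* Main.v *)
(* Summing over ordered adjacent pairs counts each edge twice. A vertex x has
   |U(A)| elements y with x + y a unit, and x itself is one of them exactly when
   2x is a unit; so the degrees are all |U(A)| when 2A contains no unit. When
   2 is a unit they are |U(A)| - 1 at units and |U(A)| at nonunits, and if
   moreover A is local, the neighbours of a nonunit are exactly the units, which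
   determines the number of edges of each degree type. *)

Require Import Defs.
From mathcomp Require Import all_boot all_order all_algebra.
From mathcomp Require Import reals ring.

Import Order.TTheory GRing.Theory Num.Theory.
Local Open Scope ring_scope.

Lemma setU2_eq (T : finType) (a b x y : T) : a != b ->
  ([set x; y] == [set a; b]) = ((x, y) == (a, b)) || ((x, y) == (b, a)).
Proof.
move=> ab; apply/eqP/idP => [E|]; last first.
  by case/orP=> /eqP[-> ->] //; apply: setUC.
have xE : x \in [set a; b] by rewrite -E set21.
have yE : y \in [set a; b] by rewrite -E set22.
have aE : a \in [set x; y] by rewrite E set21.
have bE : b \in [set x; y] by rewrite E set22.
move: xE yE aE bE; rewrite !inE !xpair_eqE.
case/orP=> /eqP-> /orP[]/eqP->; rewrite ?eqxx ?orbT ?orbb //.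
- by rewrite eq_sym (negbTE ab).
- by rewrite (negbTE ab).
Qed.

(** The map from ordered adjacent pairs to edges, [(x, y)] to [[set x; y]], is two-to-one. The
    weight [f] is arbitrary, so that it can later be the Sombor weight of an edge. *)
Lemma handshake (V : nmodType) (T : finType) (G : sgraph T)
    (f : {set T} -> V) :
  \sum_x \sum_(y | adj G x y) f [set x; y] = (\sum_(e in edges G) f e) *+ 2.
Proof.
rewrite pair_big_dep /= -sumrMnl.
rewrite (partition_big (fun q => [set q.1; q.2]) (mem (edges G))) /=; last first.
  case=> x y /= xy; rewrite inE; apply/existsP; exists x.
  by apply/existsP; exists y; rewrite xy eqxx.
apply: eq_bigr => e; rewrite inE => /existsP[a /existsP[b /andP[ab /eqP->]]].
have nab : a != b by apply: contraTneq ab => ->; rewrite adj_irrefl.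
(* The fibre over the edge [[set a; b]] consists of its two orientations, distinct because there are
   no loops. *)
rewrite (eq_bigl (mem [:: (a, b); (b, a)])) => [|[x y] /=]; last first.
  rewrite !inE setU2_eq //; case: eqP => [[-> ->]|_] /=; first by rewrite ab.
  by case: eqP => [[-> ->]|_]; rewrite ?andbF // adj_sym ab.
rewrite -big_uniq /= ?inE ?xpair_eqE ?(negbTE nab) //=.
by rewrite !big_cons big_nil /= addr0 (setUC [set b]).
Qed.

Lemma sombor_double (R : realType) (T : finType) (G : sgraph T) :
  sombor R G *+ 2 = \sum_x \sum_(y | adj G x y)
    Num.sqrt ((degree G x)%:R ^+ 2 + (degree G y)%:R ^+ 2).
Proof.
rewrite /sombor -handshake; apply: eq_bigr => x _; apply: eq_bigr => y xy.
rewrite big_setU1 ?big_set1 // inE.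
by apply: contraTneq xy => ->; rewrite adj_irrefl.
Qed.

(** Translation by [x] is a bijection, so [x + y] is a unit for as many [y] as there are units; the
    second summand accounts for the excluded [y = x]. The additive form avoids truncated
    subtraction. *)
Lemma degree_unit_graph (A : finComUnitRingType) (x : A) :
  (degree (unit_graph A) x + ((x + x)%R \is a GRing.unit)
     = #|[pred u : A | u \is a GRing.unit]|)%N.
Proof.
have <- : #|[set y | x + y \is a GRing.unit]|
            = #|[pred u : A | u \is a GRing.unit]|.
  rewrite -(card_imset _ (addrI x)); apply: eq_card => u; rewrite !inE.
  apply/imsetP/idP => [[y]|uU]; first by rewrite inE => ? ->.
  by exists (u - x); rewrite ?inE addrC subrK.
rewrite [RHS](cardsD1 x) inE addnC; congr (_ + _)%N; apply: eq_card => y.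
by rewrite !inE /= /unit_adj eq_sym.
Qed.

Lemma sqrt_sqrD_diag (R : realType) (d : nat) :
  Num.sqrt (d%:R ^+ 2 + d%:R ^+ 2) = d%:R * Num.sqrt 2%:R :> R.
Proof.
by rewrite -mulr2n -[_ *+ 2]mulr_natr sqrtrM ?sqr_ge0 // sqrtr_sqr normr_nat.
Qed.

(** Undoes the double counting of edges: half of the square root of 2 is its inverse. *)
Lemma mulr2_sqrt2V (R : realType) (s x : R) :
  s *+ 2 = x * Num.sqrt 2%:R -> s = x / Num.sqrt 2%:R.
Proof.
have s2 : Num.sqrt 2%:R != 0 :> R by rewrite gt_eqF // sqrtr_gt0 ltr0n.
have q2 : Num.sqrt 2%:R ^+ 2 = 2%:R :> R by rewrite sqr_sqrtr // ler0n.
move=> E; apply: (mulIf s2); rewrite divfK //; apply: (mulIf s2).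
by rewrite -E -mulrA -expr2 q2 mulr_natr.
Qed.

Lemma sum_const_card (R : pzSemiRingType) (I : finType) (P : pred I)
    (F : I -> R) (c : R) : (forall i, P i -> F i = c) ->
  \sum_(i | P i) F i = #|[pred i | P i]|%:R * c.
Proof. by move=> Fc; rewrite mulr_natl -sumr_const; apply: eq_bigr. Qed.

Lemma sombor_unit_graph_regular (R : realType) (A : finComUnitRingType)
    (u := #|[pred x : A | x \is a GRing.unit]|) :
  (forall x : A, x + x \isn't a GRing.unit) ->
  sombor R (unit_graph A) = #|A|%:R * u%:R ^+ 2 / Num.sqrt 2%:R.
Proof.
move=> dblN; have degE x : degree (unit_graph A) x = u.
  by have := degree_unit_graph A x; rewrite (negbTE (dblN x)) addn0.
apply: mulr2_sqrt2V; rewrite sombor_double.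
rewrite (sum_const_card _ _ _ _ (u%:R * (u%:R * Num.sqrt 2%:R))).
  by rewrite (eq_card (B := A)) //; ring.
move=> x _; rewrite -{1}(degE x) [X in X%:R * _]/degree cardsE.
by apply: sum_const_card => y _; rewrite !degE sqrt_sqrD_diag.
Qed.

Section Local.

Variables (A : finComUnitRingType).
(** Locality of [A] in the form used below; it is equivalent to the nonunits being closed under
    addition. *)
Hypothesis unitD_nonunit : forall x y : A, x \isn't a GRing.unit ->
  (x + y \is a GRing.unit) = (y \is a GRing.unit).
Hypothesis unit2 : (2%:R : A) \is a GRing.unit.

Let u := #|[pred x : A | x \is a GRing.unit]|.

Lemma degree_unit_graph_local (x : A) :
  (degree (unit_graph A) x + (x \is a GRing.unit) = u)%N.
Proof.
by rewrite -[u](degree_unit_graph A x) -mulr2n -mulr_natr unitrMl.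
Qed.

Lemma adj_unit_graph_nonunit (x y : A) : x \isn't a GRing.unit ->
  adj (unit_graph A) x y = (y \is a GRing.unit).
Proof.
move=> xN; rewrite /= /unit_adj unitD_nonunit //.
by case: eqP => // <-; rewrite (negbTE xN).
Qed.

(** No two nonunits are adjacent. Each unit-nonunit pair is an edge of weight [S], and the bracket
    counts ordered adjacent pairs of units, each of weight [u - 1] times the square root of 2. *)
Lemma sombor_unit_graph_local (R : realType) :
  sombor R (unit_graph A) =
    u%:R * (#|A|%:R - u%:R) * Num.sqrt (u%:R ^+ 2 + (u%:R - 1) ^+ 2)
    + (u%:R * (u%:R - 1) - (#|A|%:R - u%:R) * u%:R) * (u%:R - 1)
      / Num.sqrt 2%:R.
Proof.
have nonunits : #|[pred x : A | x \isn't a GRing.unit]|%:R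
    = #|A|%:R - u%:R :> R.
  rewrite -(cardC [pred x : A | x \is a GRing.unit]) natrD addrC addKr.
  by congr _%:R; apply: eq_card.
have degU (x : A) : x \is a GRing.unit ->
    (degree (unit_graph A) x)%:R = u%:R - 1 :> R.
  by move=> xU; rewrite -(degree_unit_graph_local x) xU natrD addrK.
have degN (x : A) : x \isn't a GRing.unit -> degree (unit_graph A) x = u.
  by move=> xN; rewrite -(degree_unit_graph_local x) (negbTE xN) addn0.
set S := Num.sqrt (_ + _).
suff tot : sombor R (unit_graph A) *+ 2 = (u%:R * (#|A|%:R - u%:R) * S) *+ 2
    + (u%:R * (u%:R - 1) - (#|A|%:R - u%:R) * u%:R) * (u%:R - 1)
      * Num.sqrt 2%:R.
  apply/eqP; rewrite addrC -subr_eq; apply/eqP/mulr2_sqrt2V.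
  by rewrite mulrnBl tot addrC addKr.
rewrite sombor_double (bigID (fun x : A => x \is a GRing.unit)) /=.
have -> : \sum_(x : A | x \isn't a GRing.unit)
    \sum_(y | adj (unit_graph A) x y) Num.sqrt
      ((degree (unit_graph A) x)%:R ^+ 2 + (degree (unit_graph A) y)%:R ^+ 2)
    = (#|A|%:R - u%:R) * (u%:R * S).
  rewrite -nonunits; apply: sum_const_card => x xN.
  under eq_bigl do rewrite adj_unit_graph_nonunit //.
  by apply: sum_const_card => y yU; rewrite degN // degU.
(* A unit is adjacent to every nonunit; its other neighbours are units, of the same degree
   [u - 1]. *)
have -> : \sum_(x : A | x \is a GRing.unit)
    \sum_(y | adj (unit_graph A) x y) Num.sqrt
      ((degree (unit_graph A) x)%:R ^+ 2 + (degree (unit_graph A) y)%:R ^+ 2)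
    = u%:R * ((#|A|%:R - u%:R) * S + (u%:R - 1 - (#|A|%:R - u%:R))
                * ((u%:R - 1) * Num.sqrt 2%:R)).
  apply: sum_const_card => x xU.
  rewrite (bigID (fun y : A => y \isn't a GRing.unit)) /=.
  have nbrN y : adj (unit_graph A) x y && (y \isn't a GRing.unit)
      = (y \isn't a GRing.unit).
    case yN: (y \isn't a GRing.unit); rewrite ?andbF // andbT adj_sym.
    by rewrite adj_unit_graph_nonunit.
  congr (_ + _).
    rewrite (eq_bigl _ _ nbrN) -nonunits; apply: sum_const_card => y yN.
    by rewrite degU // degN // addrC.
  (* The unit neighbours number the degree of [x] minus all the nonunits. *)
  have -> : u%:R - 1 - (#|A|%:R - u%:R) =
      #|[pred y | adj (unit_graph A) x y & ~~ (y \isn't a GRing.unit)]|%:R :> R.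
    rewrite -(degU x xU) -nonunits /degree cardsE.
    rewrite -(cardID [pred y : A | y \isn't a GRing.unit]) natrD.
    rewrite (@eq_card _ _ [pred y : A | y \isn't a GRing.unit]) => [|y].
      by rewrite addrC addKr; congr _%:R; apply: eq_card => y; rewrite !inE andbC.
    exact: nbrN.
  apply: (sum_const_card _ _ (fun y => adj (unit_graph A) x y
    && ~~ (y \isn't a GRing.unit))) => y /andP[_]; rewrite negbK => yU.
  by rewrite -(degU x xU) -sqrt_sqrD_diag !degU.
by ring.
Qed.

End Local.

Lemma card_unit_Zp (n : nat) : (1 < n)%N ->
  #|[pred x : 'Z_n | x \is a GRing.unit]| = totient n.
Proof.
move=> n1; rewrite -(card_units_Zp (ltnW n1)) cardsT card_sub.
by apply: eq_card => x; rewrite !inE.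
Qed.

(* 'Z_n is the ring of integers modulo n because 1 < n. *)
Theorem theorem4p1 (R : realType) (n p : nat)
    (hn : (2 <= n)%N) (hp : prime p) :
  (~~ odd n ->
     sombor R (unit_graph 'Z_n) =
       n%:R * (totient n)%:R ^+ 2 / Num.sqrt 2%:R)
  /\
  (forall alpha : nat, (1 <= alpha)%N -> n = (p ^ alpha)%N -> (2 < p)%N ->
     sombor R (unit_graph 'Z_n) =
       (totient n)%:R * (n%:R - (totient n)%:R)
         * Num.sqrt ((totient n)%:R ^+ 2 + ((totient n)%:R - 1) ^+ 2)
       + ((totient n)%:R * ((totient n)%:R - 1)
            - (n%:R - (totient n)%:R) * (totient n)%:R)
         * ((totient n)%:R - 1) / Num.sqrt 2%:R).
Proof.
have cardZ : #|'Z_n| = n by rewrite card_ord Zp_cast.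
split=> [n_even|alpha alpha_gt0 nE p_gt2].
  (* For even [n], 2 is not coprime to [n], so no multiple of 2 is a unit. *)
  have dblN (x : 'Z_n) : x + x \isn't a GRing.unit.
    rewrite -mulr2n -mulr_natr unitrM unitZpE // coprimen2.
    by rewrite (negbTE n_even) andbF.
  by rewrite (sombor_unit_graph_regular R _ dblN) cardZ card_unit_Zp.
(* Modulo a power of [p], the nonunits are the multiples of [p]; locality then reduces to
   divisibility of a sum by [p]. *)
have unitE (k : nat) : ((k%:R : 'Z_n) \is a GRing.unit) = ~~ (p %| k)%N.
  by rewrite unitZpE // {1}nE coprime_pexpl // prime_coprime.
have unitD (x y : 'Z_n) : x \isn't a GRing.unit ->
    (x + y \is a GRing.unit) = (y \is a GRing.unit).
  rewrite -[x]natr_Zp -[y]natr_Zp -natrD !unitE negbK => px.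
  by rewrite dvdn_addr.
have unit2 : (2%:R : 'Z_n) \is a GRing.unit by rewrite unitE gtnNdvd.
by rewrite (sombor_unit_graph_local _ unitD unit2) cardZ card_unit_Zp.
Qed.
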